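(* Let $n\ge 4$ and $2\le t\le 2n-3$ be integers, and let $r$ be the remainder of $n-1$ divided by $1+t$. Then $$\kappa(B_n;K_{1,t})=\kappa^s(B_n;K_{1,t})=\begin{cases}\dfrac{2n-4}{1+t}+1, & \text{if } 2\le t\le n-3 \text{ and } r=1,\\[2mm] 2\left\lceil\dfrac{n-1}{1+t}\right\rceil, & \text{otherwise.}\end{cases}$$
   Context: All graphs are finite and simple. $K_{1,t}$ is the star with one center and $t$ leaves. Structure connectivity. For a set $\mathcal{F}$ of subgraphs of a connected graph $G$ (no disjointness is required), let $V(\mathcal{F})$ be the union of the vertex sets of its members and $G-\mathcal{F}=G-V(\mathcal{F})$. $\mathcal{F}$ is a subgraph cut of $G$ if $G-\mathcal{F}$ is disconnected or is a trivial graph (a single vertex). For a connected graph $H$, an $H$-structure cut (resp. $H$-substructure cut) is a subgraph cut each of whose members is isomorphic to $H$ (resp. to a connected subgraph of $H$). $\kappa(G;H)$ (resp. $\kappa^s(G;H)$) is the minimum cardinality of an $H$-structure cut (resp. $H$-substructure cut) of $G$. Crossed cube. Two binary strings $x_1x_0$, $y_1y_0$ are pair related, $x_1x_0\sim y_1y_0$, iff $(x_1x_0,y_1y_0)\in\{(00,00),(10,10),(01,11),(11,01)\}$. $CQ_1=K_2$ with vertices $0,1$. For $n\ge 2$, $CQ_n$ consists of two copies $CQ_{n-1}^0,CQ_{n-1}^1$ of $CQ_{n-1}$ (labels prefixed by $0$ and $1$ respectively), together with an edge between $u=0u_{n-2}\cdots u_0$ and $v=1v_{n-2}\cdots v_0$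 iff $u_{n-2}=v_{n-2}$ when $n$ is even, and $u_{2i+1}u_{2i}\sim v_{2i+1}v_{2i}$ for all $0\le i<\lfloor\frac{n-1}{2}\rfloor$. BCDC network. $B_2$ is the $4$-cycle with vertices $[00,01],[00,10],[01,11],[10,11]$ (two of these being adjacent iff they share an entry). For $n\ge 3$, $B_{n-1}^0$ (resp. $B_{n-1}^1$) is the copy of $B_{n-1}$ obtained by prefixing both entries of each vertex $[x,y]$ with $0$ (resp. $1$), and $B_n$ consists of $B_{n-1}^0$, $B_{n-1}^1$ and the independent set $S_n=\{[a,b]: a\in V(CQ_{n-1}^0), b\in V(CQ_{n-1}^1), (a,b)\in E(CQ_n)\}$, where $[a,b]\in V(B_{n-1}^0)$ is adjacent to $[c,d]\in S_n$ iff $a=c$ or $b=c$, and $[c,d]\in S_n$ is adjacent to $[e,f]\in V(B_{n-1}^1)$ iff $e=d$ or $f=d$ (there are no edges between $B_{n-1}^0$ and $B_{n-1}^1$). Equivalently, $B_n$ is the line graph of $CQ_n$. *)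

(* Defs.v *)
From mathcomp Require Import all_boot.

Set Implicit Arguments.
Unset Strict Implicit.
Unset Printing Implicit Defensive.

Record sgraph := SGraph {
  svertex :> finType;
  sadj : rel svertex;
  sadj_sym : symmetric sadj;
  sadj_irr : irreflexive sadj
}.

Definition isomorphic (G H : sgraph) : Prop :=
  exists2 f : G -> H, bijective f & {mono f : x y / sadj x y}.

(* The null graph is neither connected nor disconnected. *)
Definition connected (G : sgraph) : bool :=
  (0 < #|G|) && [forall x : G, forall y : G, connect (@sadj G) x y].

Definition disconnected (G : sgraph) : bool :=
  [exists x : G, exists y : G, ~~ connect (@sadj G) x y].

Definition trivial_graph (G : sgraph) : bool := #|G| == 1.

Section Induced.
Variables (G : sgraph) (A : {set G}).

Definition induced_adj : rel {x : G | x \in A} :=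
  fun x y => sadj (val x) (val y).

Lemma induced_adj_sym : symmetric induced_adj.
Proof. by move=> x y; rewrite /induced_adj sadj_sym. Qed.

Lemma induced_adj_irr : irreflexive induced_adj.
Proof. by move=> x; rewrite /induced_adj sadj_irr. Qed.

Definition induced : sgraph := SGraph induced_adj_sym induced_adj_irr.

End Induced.

(* A subgraph of G is a pair (V, E) where E is a set of edges of G, each
   represented as a two-element set, with both ends in V. *)
Definition is_subgraph (G : sgraph) (X : {set G} * {set {set G}}) : bool :=
  [forall e in X.2, exists x in X.1, exists y in X.1,
     sadj x y && (e == [set x; y])].

Definition subgraph (G : sgraph) : finType :=
  {X : {set G} * {set {set G}} | is_subgraph X}.

Section SubgraphGraph.
Variables (G : sgraph) (S : subgraph G).

Definition sub_vertices : {set G} := (val S).1.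
Definition sub_edges : {set {set G}} := (val S).2.

Definition sub_adj : rel {x : G | x \in sub_vertices} :=
  fun x y => [set val x; val y] \in sub_edges.

Lemma sub_adj_sym : symmetric sub_adj.
Proof. by move=> x y; rewrite /sub_adj setUC. Qed.

Lemma sub_adj_irr : irreflexive sub_adj.
Proof.
move=> x; apply/negP; rewrite /sub_adj setUid => xE.
have /forall_inP/(_ _ xE)/exists_inP[y _ /exists_inP[z _]] := valP S.
case/andP=> yz /eqP/setP xyz; move: yz.
have:= xyz z; have:= xyz y; rewrite !inE !eqxx orbT /= => /eqP-> /eqP->.
by rewrite sadj_irr.
Qed.

Definition graph_of_subgraph : sgraph := SGraph sub_adj_sym sub_adj_irr.

End SubgraphGraph.

Definition subgraph_cut (G : sgraph) (F : {set subgraph G}) : bool :=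
  let GF := induced (~: \bigcup_(S in F) sub_vertices S) in
  disconnected GF || trivial_graph GF.

Definition structure_cut (G H : sgraph) (F : {set subgraph G}) : Prop :=
  subgraph_cut F /\
  forall S, S \in F -> isomorphic (graph_of_subgraph S) H.

Definition substructure_cut (G H : sgraph) (F : {set subgraph G}) : Prop :=
  subgraph_cut F /\
  forall S, S \in F ->
    exists2 K : subgraph H, connected (graph_of_subgraph K) &
      isomorphic (graph_of_subgraph S) (graph_of_subgraph K).

Definition is_min_card (T : finType) (P : {set T} -> Prop) (k : nat) : Prop :=
  (exists2 F : {set T}, P F & #|F| = k) /\
  (forall F : {set T}, P F -> k <= #|F|).

(* [is_kappa G H k] means kappa(G; H) = k, and in particular that an
   H-structure cut of G exists; likewise for [is_kappa_s]. *)
Definition is_kappa (G H : sgraph) (k : nat) : Prop :=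
  is_min_card (@structure_cut G H) k.

Definition is_kappa_s (G H : sgraph) (k : nat) : Prop :=
  is_min_card (@substructure_cut G H) k.

(* The star K_{1,t} has center [None]. *)
Definition star_adj (t : nat) : rel (option 'I_t) :=
  fun x y => isSome x != isSome y.

Lemma star_adj_sym t : symmetric (@star_adj t).
Proof. by move=> x y; rewrite /star_adj eq_sym. Qed.

Lemma star_adj_irr t : irreflexive (@star_adj t).
Proof. by move=> x; rewrite /star_adj eqxx. Qed.

Definition star (t : nat) : sgraph :=
  SGraph (@star_adj_sym t) (@star_adj_irr t).

(* A binary string u_{n-1}...u_0 is the list [:: u_{n-1}; ...; u_0]. *)
Definition bit (u : seq bool) (i : nat) : bool := nth false (rev u) i.

Definition pair_related (x y : bool * bool) : bool :=
  (x, y) \in [:: ((false, false), (false, false));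
                 ((true, false), (true, false));
                 ((false, true), (true, true));
                 ((true, true), (false, true))].

(* The condition on the last n-1 bits of the ends of an edge of CQ_n that
   joins the two copies of CQ_{n-1}. *)
Definition CQ_cross (n : nat) (u v : seq bool) : bool :=
  (~~ odd n ==> (bit u (n - 2) == bit v (n - 2))) &&
  [forall i : 'I_((n - 1) %/ 2),
     pair_related (bit u (2 * i + 1), bit u (2 * i))
                  (bit v (2 * i + 1), bit v (2 * i))].

(* Adjacency of CQ_n, meaningful on strings of length n only. *)
Fixpoint CQ_adj (n : nat) (u v : seq bool) : bool :=
  match n with
  | 0 => false
  | 1 => u != v
  | n'.+1 =>
      match u, v with
      | false :: u', false :: v' | true :: u', true :: v' => CQ_adj n' u' v'
      | false :: _, true :: _ => CQ_cross n u v
      | true :: _, false :: _ => CQ_cross n v u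
      | _, _ => false
      end
  end.

(* A vertex [x, y] of B_n is stored as the ordered pair (x, y): in the
   recursive construction the entries always come in lexicographic order. *)
Fixpoint BCDC_vertex (n : nat) (p : seq bool * seq bool) : bool :=
  match n with
  | 0 | 1 => false
  | 2 => p \in [:: ([:: false; false], [:: false; true]);
                   ([:: false; false], [:: true; false]);
                   ([:: false; true], [:: true; true]);
                   ([:: true; false], [:: true; true])]
  | n'.+1 =>
      match p with
      | (false :: x, false :: y) | (true :: x, true :: y) =>
          BCDC_vertex n' (x, y)
      | (false :: _, true :: _) => CQ_adj n p.1 p.2
      | _ => false
      end
  end.

(* Adjacency of B_n, meaningful on pairs satisfying [BCDC_vertex n] only.
   For n >= 3, the pairs prefixed by (0, 0), (1, 1) and (0, 1) are the
   vertices of B_{n-1}^0, B_{n-1}^1 and S_n respectively. *)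
Fixpoint BCDC_rel (n : nat) (p q : seq bool * seq bool) : bool :=
  match n with
  | 0 | 1 => false
  | 2 => (p != q) &&
         [|| p.1 == q.1, p.1 == q.2, p.2 == q.1 | p.2 == q.2]
  | n'.+1 =>
      match p, q with
      | (false :: a, false :: b), (false :: c, false :: d)
      | (true :: a, true :: b), (true :: c, true :: d) =>
          BCDC_rel n' (a, b) (c, d)
      | (false :: a, false :: b), (false :: c, true :: _)
      | (false :: c, true :: _), (false :: a, false :: b) =>
          (a == c) || (b == c)
      | (false :: _, true :: d), (true :: e, true :: f)
      | (true :: e, true :: f), (false :: _, true :: d) =>
          (e == d) || (f == d)
      | _, _ => false
      end
  end.

Section BCDC.
Variable n : nat.

Definition BCDC_type : finType :=
  {p : n.-tuple bool * n.-tuple bool |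
    BCDC_vertex n (tval p.1, tval p.2)}.

Definition BCDC_adj : rel BCDC_type :=
  fun p q => BCDC_rel n (tval (val p).1, tval (val p).2)
                        (tval (val q).1, tval (val q).2).

Lemma BCDC_rel_sym m : symmetric (BCDC_rel m).
Proof.
elim: m => [|[|[|m]] IH] // p q.
  case: p q => [a b] [c d] /=; rewrite eq_sym.
  rewrite (eq_sym a c) (eq_sym a d) (eq_sym b c) (eq_sym b d).
  by case: (c == a); case: (d == a); case: (c == b); case: (d == b).
by case: p q => [[|[] a] [|[] b]] [[|[] c] [|[] d]] //;
  exact: (IH (a, b) (c, d)).
Qed.

Lemma BCDC_rel_irr m : irreflexive (BCDC_rel m).
Proof.
elim: m => [|[|[|m]] IH] //= p; first by rewrite eqxx.
by case: p => [[|[] a] [|[] b]] //; exact: (IH (a, b)).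
Qed.

Lemma BCDC_adj_sym : symmetric BCDC_adj.
Proof. by move=> p q; apply: BCDC_rel_sym. Qed.

Lemma BCDC_adj_irr : irreflexive BCDC_adj.
Proof. by move=> p; apply: BCDC_rel_irr. Qed.

Definition BCDC : sgraph := SGraph BCDC_adj_sym BCDC_adj_irr.

End BCDC.

Definition ceil_divn (m d : nat) : nat := m %/ d + ~~ (d %| m).

(* Main.v *)
Require Import Defs.
From mathcomp Require Import all_boot.
From mathcomp Require Import zify.

Set Implicit Arguments.
Unset Strict Implicit.
Unset Printing Implicit Defensive.

(** The BCDC network B_n is the line graph of the crossed cube CQ_n, so its
vertices are the edges of CQ_n.  Write D for the union of the vertex sets of
a family of stars.  In CQ_n every vertex has degree n, there is no triangle,
and two distinct edges share at most one end; hence the neighbourhood of a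
vertex e = uv of B_n is the disjoint union of two cliques with n - 1 vertices
each, one for each end of e, and no edge of B_n joins the two.

Upper bound.  Covering the two cliques separately by stars that avoid e takes
2 * ceil((n - 1) / (1 + t)) stars and isolates e.  When n - 1 leaves remainder
1 modulo 1 + t, one vertex of each clique is left over after both have been
packed with full stars.  If e lies on a 4-cycle u, v, z, w of CQ_n, the
left-overs can be chosen as uw and vz; the edge wz is adjacent to both, so a
single star centred there finishes the job ([kappa_upper]).

Lower bound.  If B_n minus D is disconnected or a single vertex, then either
D contains all neighbours of some vertex e outside D, or D has at least
3 n - 4 elements ([cut_isolates_or_large]).  Indeed, let A be the set of ends
of the edges in a component of the remainder.  All edges of CQ_n between A and
its complement are in D.  If A and its complement both have three vertices or
more, the edge boundary of A has size at least 3 n - 4 ([boundary_ge]);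
otherwise one of the two is just the pair of ends of a surviving edge, whose
neighbours are therefore all in D.

In the first case a star that avoids e meets only one of the two cliques,
unless its centre lies outside both, and then it takes at most one vertex from
each ([starlike_two_cliques]).  A star thus spends its 1 + t vertices on one
clique or gives one vertex to each, and counting yields the stated value
([kappa_le_isolated]).  In the second case the stars have at most
(1 + t) |F| vertices altogether, and 3 n - 4 is already too many for fewer
stars than the stated value ([kappa_le_spread]).

The bound 3 n - 4 is proved by induction along the decomposition of CQ_n into
two copies of CQ_(n-1) joined by a perfect matching: the boundary of A
contains the boundaries of its two traces, and at least as many matching edges
as the sizes of the traces differ ([boundaryS]). *)

(** * Subgraphs of stars *)

Definition nbr (G : sgraph) (x : G) : {set G} := [set y | sadj x y].

(** The vertex sets of connected subgraphs of K_(1,t) inside G; this is all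
that the lower bound uses about the members of a substructure cut. *)
Definition starlike (G : sgraph) (t : nat) (X : {set G}) : Prop :=
  exists c, [/\ c \in X, X \subset c |: nbr c & #|X| <= t.+1].

Definition removed (G : sgraph) (F : {set subgraph G}) : {set G} :=
  \bigcup_(S in F) sub_vertices S.

(** Edges of a subgraph are unordered pairs, so the pair has to be matched
with a pair of adjacent vertices in either order. *)
Lemma sub_edge_adj (G : sgraph) (S : subgraph G) x y :
  [set x; y] \in sub_edges S -> sadj x y.
Proof.
move=> xyS; have /forall_inP/(_ _ xyS)/exists_inP[a _ /exists_inP[b _]] := valP S.
case/andP=> ab /eqP/setP eq_xy.
have nab : a != b by apply: contraTneq ab => ->; rewrite sadj_irr.
have := eq_xy a; have := eq_xy b; have := eq_xy x; have := eq_xy y.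
rewrite !inE !eqxx /= !orbT.
move=> /esym/orP[] /eqP-> /esym/orP[] /eqP-> //; rewrite ?orbb ?(sadj_sym b) //.
  by rewrite eq_sym (negPf nab).
by rewrite (negPf nab).
Qed.

Lemma isomorphic_sym (G H : sgraph) : isomorphic G H -> isomorphic H G.
Proof.
case=> f [g fK gK] fM; exists g; first by exists f.
by move=> x y; rewrite -{2}(gK x) -{2}(gK y) fM.
Qed.

Lemma isomorphic_trans (G H K : sgraph) :
  isomorphic G H -> isomorphic H K -> isomorphic G K.
Proof.
case=> f bf fM [g bg gM]; exists (g \o f); first exact: bij_comp.
by move=> x y /=; rewrite gM fM.
Qed.

Lemma card_graph_of_subgraph (G : sgraph) (S : subgraph G) :
  #|graph_of_subgraph S| = #|sub_vertices S|.
Proof. by rewrite card_sig; apply: eq_card => x; rewrite !inE. Qed.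

Lemma connect_first (T : finType) (e : rel T) x y :
  connect e x y -> x != y -> exists2 z, e x z & connect e z y.
Proof.
case/connectP=> -[|z p] /= => [_ ->|]; first by rewrite eqxx.
by case/andP=> xz zp -> _; exists z => //; apply/connectP; exists p.
Qed.

(** A connected subgraph of a star has a vertex adjacent to all the others:
the centre of the star if it is present, and otherwise the only vertex, since
two leaves can only be connected through the centre. *)
Lemma substructure_starlike (G : sgraph) t (S : subgraph G)
    (K : subgraph (star t)) :
  connected (graph_of_subgraph K) ->
  isomorphic (graph_of_subgraph S) (graph_of_subgraph K) ->
  starlike t (sub_vertices S).
Proof.
case/andP=> /card_gt0P[k1 _] /forallP conK [f bij_f f_mono].
(* The centre if K contains it, any vertex of K otherwise. *)
have [k0 k0P] : exists k0 : graph_of_subgraph K,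
    forall k, val k = None -> k = k0.
  have [k /eqP kN|noN] := pickP [pred k : graph_of_subgraph K | val k == None].
    by exists k => l lN; apply: val_inj; rewrite lN.
  by exists k1 => k kN; have:= noN k; rewrite /= kN eqxx.
have center k : k != k0 -> @sadj (graph_of_subgraph K) k k0.
  move=> nk; have [z kz _] := connect_first (forallP (conK k) k0) nk.
  have := sub_edge_adj kz; rewrite /= /star_adj.
  case kE: (val k) nk => [i|] nk; last by rewrite (k0P _ kE) eqxx in nk.
  by case zE: (val z) => [//|] _; rewrite -(k0P _ zE).
have [g fK gK] := bij_f.
exists (val (g k0)); split; first exact: (valP (g k0)).
  apply/subsetP=> x xS; rewrite !inE; set x' : graph_of_subgraph S := Sub x xS.
  have [<-|nx] := eqVneq x' (g k0); first by rewrite eqxx.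
  apply/orP; right; rewrite sadj_sym; apply: (@sub_edge_adj _ S).
  have: @sadj (graph_of_subgraph K) (f x') (f (g k0)).
    by rewrite gK; apply: center; apply: contra nx => /eqP <-; rewrite fK.
  by rewrite f_mono.
rewrite -card_graph_of_subgraph (bij_eq_card bij_f).
rewrite card_graph_of_subgraph; apply: leq_trans (max_card _) _.
by rewrite card_option card_ord.
Qed.

Lemma full_subgraph_proof (G : sgraph) :
  is_subgraph (setT : {set G},
    [set [set p.1; p.2] | p in [set p : G * G | sadj p.1 p.2]]).
Proof.
apply/forall_inP => /= _ /imsetP[[x y] + ->]; rewrite inE /= => xy.
by apply/exists_inP; exists x => //; apply/exists_inP; exists y; rewrite ?xy /=.
Qed.

Definition full_subgraph (G : sgraph) : subgraph G := Sub _ (full_subgraph_proof G).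

Lemma full_subgraph_iso (G : sgraph) :
  isomorphic G (graph_of_subgraph (full_subgraph G)).
Proof.
exists (fun x => Sub x (in_setT x)).
  by exists val => [x|x]; [exact: SubK | apply: val_inj; exact: SubK].
move=> x y; apply/idP/idP => [|xy].
  exact: (@sub_edge_adj _ (full_subgraph G)).
by apply/imsetP; exists (x, y); rewrite ?inE.
Qed.

Lemma isomorphic_connected (G H : sgraph) :
  isomorphic G H -> connected G -> connected H.
Proof.
case=> f bij_f f_mono /andP[G0 /forallP conG].
rewrite /connected -(bij_eq_card bij_f) G0; have [g fK gK] := bij_f.
apply/forallP=> x; apply/forallP=> y.
have /connectP[p pP yE] := forallP (conG (g x)) (g y).
apply/connectP; exists (map f p); last by rewrite -[x]gK last_map -yE gK.
rewrite -{1}[x]gK path_map; apply: sub_path pP => u v /=.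
by rewrite f_mono.
Qed.

Lemma star_connected t : connected (star t).
Proof.
apply/andP; split; first by apply/card_gt0P; exists None.
have cN (x : star t) : connect (@star_adj t) x None.
  by case: x => [i|]; [apply: connect1 | apply: connect0].
apply/forallP=> x; apply/forallP=> y; apply: connect_trans (cN x) _.
by case: y => [j|]; [apply: connect1 | apply: connect0].
Qed.

(** K_(1,t) is a connected subgraph of itself, so upper bounds for structure
cuts pass to substructure cuts, and lower bounds the other way. *)
Lemma structure_substructure (G : sgraph) t (F : {set subgraph G}) :
  structure_cut (star t) F -> substructure_cut (star t) F.
Proof.
case=> cutF isoF; split=> // S SF; exists (full_subgraph (star t)).
  exact: isomorphic_connected (full_subgraph_iso _) (star_connected t).
exact: isomorphic_trans (isoF S SF) (full_subgraph_iso _).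
Qed.

(** * Covering cliques by stars *)

Section Star.
Variables (G : sgraph) (c : G) (L : {set G}).
Hypothesis Lc : L \subset nbr c.

Lemma star_subgraph_proof : is_subgraph (c |: L, [set [set c; y] | y in L]).
Proof.
apply/forall_inP => /= _ /imsetP[y yL ->].
apply/exists_inP; exists c; first by rewrite !inE eqxx.
apply/exists_inP; exists y; first by rewrite !inE yL orbT.
by have := subsetP Lc _ yL; rewrite inE => ->/=.
Qed.

Definition star_subgraph : subgraph G := Sub _ star_subgraph_proof.

Lemma sub_vertices_star : sub_vertices star_subgraph = c |: L.
Proof. by []. Qed.

Lemma star_subgraph_iso : isomorphic (graph_of_subgraph star_subgraph) (star #|L|).
Proof.
apply: isomorphic_sym.
have cL : c \notin L.
  by apply: contraT => /negPn /(subsetP Lc); rewrite inE sadj_irr.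
pose h (o : star #|L|) : G := if o is Some i then enum_val i else c.
have hP o : h o \in c |: L.
  by case: o => [i|]; rewrite !inE ?eqxx // enum_valP orbT.
pose g o : graph_of_subgraph star_subgraph := Sub (h o) (hP o).
have enum_c (i : 'I_#|L|) : (enum_val i == c) = false.
  by apply: contraNF cL => /eqP <-; exact: enum_valP.
have hI : injective h.
  move=> [i|] [j|] //= => [/enum_val_inj-> //|iE|jE].
    by have := enum_c i; rewrite iE eqxx.
  by have := enum_c j; rewrite -jE eqxx.
exists g.
  apply: inj_card_bij => [x y /(congr1 val)|]; first exact: hI.
  by rewrite card_graph_of_subgraph cardsU1 cL card_option card_ord.
move=> x y; apply/idP/idP => [/imsetP[z zL /setP hE]|].
  have hc := hE c; have hz := hE z; have hx := hE (h x); have hy := hE (h y).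
  rewrite !inE !eqxx /= in hc hz hx hy.
  have nzc : z != c by apply: contraTneq zL => ->.
  case: x y {hE} hc hz hx hy => [i|] [j|] //=.
    by rewrite ![c == _]eq_sym !enum_c.
  by rewrite orbb (negPf nzc).
rewrite /sadj /= /star_adj; case: x y => [i|] [j|] //= _; apply/imsetP.
  by exists (enum_val i); [exact: enum_valP | rewrite setUC].
by exists (enum_val j); [exact: enum_valP | ].
Qed.

End Star.

Lemma exists_subset_between (T : finType) (A B : {set T}) k :
  A \subset B -> #|A| <= k <= #|B| ->
  exists C : {set T}, [/\ A \subset C, C \subset B & #|C| = k].
Proof.
move=> AB /andP[]; elim: k => [|k IHk] Ak kB.
  by exists A; split=> //; apply/eqP; rewrite -leqn0.
have [kA|ltA] := eqVneq #|A| k.+1; first by exists A.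
have [||C [AC CB Ck]] := IHk; [by lia | exact: ltnW |].
have /card_gt0P[x] : 0 < #|B :\: C|.
  by rewrite cardsD (setIidPr CB) Ck subn_gt0.
rewrite inE => /andP[xC xB]; exists (x |: C); split.
- exact: subset_trans AC (subsetUr _ _).
- by rewrite subUset sub1set xB.
- by rewrite cardsU1 xC Ck.
Qed.

(** Prescribed leaves can be completed to a star with exactly t leaves that
still avoids e, as soon as the centre has t neighbours other than e.  The
extra leaves may already be covered by other stars. *)
Lemma star_avoiding (G : sgraph) t (e c : G) (X : {set G}) :
  e != c -> X \subset nbr c :\ e -> #|X| <= t <= #|nbr c :\ e| ->
  exists S : subgraph G, [/\ isomorphic (graph_of_subgraph S) (star t),
    c |: X \subset sub_vertices S & e \notin sub_vertices S].
Proof.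
move=> nec Xc tP; have [L [XL Le <-]] := exists_subset_between Xc tP.
have Lc : L \subset nbr c := subset_trans Le (subsetDl _ _).
exists (star_subgraph Lc); split; first exact: star_subgraph_iso.
  exact: setUS.
rewrite sub_vertices_star !inE (negPf nec) /=.
by apply/negP=> /(subsetP Le); rewrite !inE eqxx.
Qed.

Definition star_family (G : sgraph) t (e : G) (F : {set subgraph G}) : Prop :=
  forall S, S \in F -> isomorphic (graph_of_subgraph S) (star t) /\
                       e \notin sub_vertices S.

Lemma ceil_divn0 d : ceil_divn 0 d = 0.
Proof. by rewrite /ceil_divn div0n dvdn0. Qed.

Lemma ceil_divn_gt0 m d : 0 < d -> 0 < m -> 0 < ceil_divn m d.
Proof.
move=> d0 m0; rewrite /ceil_divn.
have [dm|_] := boolP (d %| m); last by rewrite addn1.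
by rewrite addn0 divn_gt0 // dvdn_leq.
Qed.

Lemma ceil_divnS m d : 0 < d -> ceil_divn (m + d) d = (ceil_divn m d).+1.
Proof.
by move=> d0; rewrite /ceil_divn divnDr // divnn d0 dvdn_addl // addn1.
Qed.

(** Greedy packing: a vertex c of the clique and t further ones (or all the
remaining ones) form a star centred at c. *)
Lemma clique_cover (G : sgraph) t (e : G) (X : {set G}) :
  e \notin X -> {in X &, forall x y, x != y -> sadj x y} ->
  {in X, forall c, t <= #|nbr c :\ e|} ->
  exists F : {set subgraph G}, [/\ star_family t e F, X \subset removed F &
    #|F| <= ceil_divn #|X| t.+1].
Proof.
elim: {X}_.+1 {-2}X (ltnSn #|X|) => // m IHm X ltXm eX clq deg.
have [X0|/card_gt0P[c cX]] := posnP #|X|.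
  exists set0; split=> [S||]; rewrite ?inE ?cards0 //.
  by rewrite (cards0_eq X0) sub0set.
have [Y [_ YX Yt]] : exists Y : {set G}, [/\ set0 \subset Y, Y \subset X :\ c
    & #|Y| = minn t #|X :\ c|].
  by apply: exists_subset_between; rewrite ?sub0set // cards0 geq_minr.
have cY : c \notin Y by apply/negP=> /(subsetP YX); rewrite !inE eqxx.
have [|||S [isoS YS eS]] := @star_avoiding G t e c Y.
- by apply: contraNneq eX => ->.
- apply/subsetP=> y /(subsetP YX); rewrite !inE => /andP[nyc yX].
  have -> : y != e by apply: contraNneq eX => <-.
  by rewrite clq // eq_sym.
- by rewrite Yt geq_minl deg.
have cardX : #|X| = #|X :\: (c |: Y)| + (#|Y|).+1.
  rewrite cardsD (setIidPr _); last first.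
    by rewrite subUset sub1set cX (subset_trans YX) ?subsetDl.
  have := subset_leq_card YX; rewrite cardsU1 cY [#|X|](cardsD1 c) cX; lia.
have [||||F [famF XF cardF]] := IHm (X :\: (c |: Y)).
- by lia.
- by rewrite !inE (negPf eX) andbF.
- by move=> x y /setDP[xX _] /setDP[yX _]; apply: clq.
- by move=> x /setDP[xX _]; apply: deg.
exists (S |: F); split.
- by move=> S' /setU1P[->|/famF].
- rewrite /removed bigcup_setU big_set1; apply/subsetP=> x xX.
  rewrite inE; have [xcY|xcY] := boolP (x \in c |: Y).
    by rewrite (subsetP YS).
  by rewrite (subsetP XF) ?orbT // inE xcY.
rewrite cardsU1; apply: (@leq_trans (ceil_divn #|X :\: (c |: Y)| t.+1).+1).
  by rewrite -[leqRHS]add1n leq_add // leq_b1.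
have := cardsD1 c X; rewrite cX add1n => XcE.
have [le_t|lt_t] := leqP t #|X :\ c|.
  by rewrite cardX Yt (minn_idPl le_t) ceil_divnS.
have -> : #|X :\: (c |: Y)| = 0 by lia.
by rewrite ceil_divn0 ceil_divn_gt0 // XcE.
Qed.

(** The vertex e survives without neighbours, so the remainder is either e
alone or disconnected. *)
Lemma isolated_cut (G : sgraph) (F : {set subgraph G}) (e : G) :
  e \notin removed F -> nbr e \subset removed F -> subgraph_cut F.
Proof.
move=> eF nF; rewrite /subgraph_cut -/(removed F).
set GF := induced _.
have eG : e \in ~: removed F by rewrite inE.
pose e' : GF := Sub e eG.
have [/eqP one|n1] := boolP (#|GF| == 1); first by apply/orP; right; apply/eqP.
apply/orP; left.
have [y ny] : exists y, y != e'.
  apply/existsP; apply: contraNT n1; rewrite negb_exists => /forallP all_e.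
  apply/card1P; exists e' => y; rewrite !inE; symmetry.
  by have := all_e y; rewrite negbK.
apply/existsP; exists e'; apply/existsP; exists y; apply/negP=> con.
rewrite eq_sym in ny; have [z ez _] := connect_first con ny.
have := valP z; rewrite inE => /negP; apply.
by apply: (subsetP nF); rewrite inE.
Qed.

(** * Counting stars across two cliques *)

Lemma card_removedI (G : sgraph) (N : {set G}) (F : {set subgraph G}) :
  #|removed F :&: N| <= \sum_(S in F) #|sub_vertices S :&: N|.
Proof.
apply: (big_rec2 (fun D m => #|D :&: N| <= m)) => [|S m D _ IH].
  by rewrite set0I cards0.
by rewrite setIUl; apply: leq_trans (leq_add (leqnn _) IH);
   rewrite cardsU leq_subr.
Qed.

(** N1 and N2 stand for the two cliques in the neighbourhood of e; the
hypotheses record what triangle-freeness of the crossed cube gives for them. *)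
Section TwoCliques.
Variables (G : sgraph) (t : nat) (e : G) (N1 N2 : {set G}).
Hypothesis N12 : forall c, c \in N1 -> [disjoint c |: nbr c & N2].
Hypothesis N21 : forall c, c \in N2 -> [disjoint c |: nbr c & N1].
Hypothesis N_far : forall c, c != e -> c \notin N1 -> c \notin N2 ->
  #|nbr c :&: N1| <= 1 /\ #|nbr c :&: N2| <= 1.

Lemma starlike_two_cliques X : starlike t X -> e \notin X ->
  [\/ #|X :&: N1| <= t.+1 /\ #|X :&: N2| = 0,
      #|X :&: N1| = 0 /\ #|X :&: N2| <= t.+1
    | #|X :&: N1| <= 1 /\ #|X :&: N2| <= 1].
Proof.
case=> c [cX Xc Xt] eX.
have sz N : #|X :&: N| <= t.+1 := leq_trans (subset_leq_card (subsetIl X N)) Xt.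
have off (N : {set G}) : [disjoint c |: nbr c & N] -> #|X :&: N| = 0.
  move=> /(disjointWl (introT subsetP (subsetP Xc)))/disjoint_setI0->.
  by rewrite cards0.
have far (N : {set G}) : c \notin N -> #|nbr c :&: N| <= 1 -> #|X :&: N| <= 1.
  move=> cN; apply: leq_trans; apply: subset_leq_card.
  apply/subsetP=> x; rewrite !inE => /andP[/(subsetP Xc) + xN].
  rewrite !inE xN andbT => /orP[/eqP xc|//].
  by rewrite -xc xN in cN.
have [c1|c1] := boolP (c \in N1); first by constructor 1; rewrite (off _ (N12 c1)).
have [c2|c2] := boolP (c \in N2); first by constructor 2; rewrite (off _ (N21 c2)).
have nce : c != e by apply: contraNneq eX => <-.
by have [n1 n2] := N_far nce c1 c2; constructor 3; split; apply: far.
Qed.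

(** Here a and b count the stars spent on a single clique, and c those that
can give at most one vertex to each. *)
Lemma two_cliques_cover (F : {set subgraph G}) :
  (forall S, S \in F -> starlike t (sub_vertices S)) -> e \notin removed F ->
  N1 :|: N2 \subset removed F ->
  exists a b c, [/\ a + b + c = #|F|, #|N1| <= a * t.+1 + c
                  & #|N2| <= b * t.+1 + c].
Proof.
move=> starF eF; rewrite subUset => /andP[N1F N2F].
pose i1 (S : subgraph G) := #|sub_vertices S :&: N1|.
pose i2 (S : subgraph G) := #|sub_vertices S :&: N2|.
pose a S := i2 S == 0; pose b S := (i2 S != 0) && (i1 S == 0).
pose c S := (i2 S != 0) && (i1 S != 0).
have sum_le (N : {set G}) : N \subset removed F ->
    #|N| <= \sum_(S in F) #|sub_vertices S :&: N|.
  by move=> NF; rewrite -{1}(setIidPr NF) card_removedI.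
exists (\sum_(S in F) a S), (\sum_(S in F) b S), (\sum_(S in F) c S).
have split3 S : S \in F -> [/\ a S + b S + c S = 1,
    i1 S <= a S * t.+1 + c S & i2 S <= b S * t.+1 + c S].
  move=> SF; have eS : e \notin sub_vertices S.
    by apply: contra eF; apply/subsetP; apply: bigcup_sup.
  have := starlike_two_cliques (starF S SF) eS.
  rewrite /a /b /c -/(i1 S) -/(i2 S).
  move: (i1 S) (i2 S) => m1 m2; clear.
  by case: m1 m2 => [|m1] [|m2] [] -[le1 le2]; split; lia.
split.
- rewrite -!big_split /= -sum1_card; apply: eq_bigr => S SF.
  by have [] := split3 S SF.
- apply: leq_trans (sum_le _ N1F) _; rewrite big_distrl -big_split /=.
  by apply: leq_sum => S SF; have [] := split3 S SF.
- apply: leq_trans (sum_le _ N2F) _; rewrite big_distrl -big_split /=.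
  by apply: leq_sum => S SF; have [] := split3 S SF.
Qed.

End TwoCliques.

(** * Arithmetic of the optimal value *)

Definition kappa_value (n t : nat) :=
  if (2 <= t <= n - 3) && ((n - 1) %% (1 + t) == 1)
  then (2 * n - 4) %/ (1 + t) + 1
  else 2 * ceil_divn (n - 1) (1 + t).

Section Kappa.
Variables (n t : nat).
Hypotheses (hn : 4 <= n) (ht : 2 <= t <= 2 * n - 3).

(** Euclidean division of n - 1 by t + 1 puts the value in a uniform shape.
If r = 1, then n - 1 >= 3 forces q > 0, and hence t <= n - 3. *)
Lemma kappa_cases : exists q r, [/\ n - 1 = q * t.+1 + r, r < t.+1 &
  [\/ r = 0 /\ kappa_value n t = 2 * q,
      [/\ r = 1, 0 < q & kappa_value n t = 2 * q + 1]
    | 1 < r /\ kappa_value n t = 2 * q + 2]].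
Proof.
exists ((n - 1) %/ t.+1), ((n - 1) %% t.+1).
rewrite /kappa_value add1n /ceil_divn /dvdn.
have := divn_eq (n - 1) t.+1; have := ltn_pmod (n - 1) (ltn0Sn t).
move: (_ %/ _) (_ %% _) => q [|[|r]] lt_r nE; split=> //.
- by constructor 1; rewrite andbF addn0.
- have q0 : 0 < q by case: q nE; lia.
  constructor 2; split=> //.
  rewrite eqxx andbT; case: ifP => [_|]; last by nia.
  have -> : 2 * n - 4 = 2 * q * t.+1 by nia.
  by rewrite mulnK.
- by constructor 3; rewrite andbF /=; split=> //; lia.
Qed.

(** When r <= 1, the bound 2 n - 2 <= 3 n - 4 suffices.  When r > 1, fewer
than 2 q + 2 stars have at most (2 q + 1) (t + 1) vertices, which reaches
3 n - 4 = 3 q (t + 1) + 3 r - 1 only if q = 0, and then t would exceed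
2 n - 3. *)
Lemma kappa_le_spread m : 3 * n - 4 <= m * t.+1 -> kappa_value n t <= m.
Proof.
move=> m_ge; have [q [r [nE lt_r kE]]] := kappa_cases.
case: kE => [[r0 ->]|[r1 q0 ->]|[r1 ->]].
- by rewrite -(leq_pmul2r (ltn0Sn t)); nia.
- by rewrite addn1 -(ltn_pmul2r (ltn0Sn t)); nia.
- case: q nE => [|q] nE.
    have lt1 : 1 * t.+1 < m * t.+1 by lia.
    by rewrite ltn_pmul2r // in lt1.
  rewrite addn2 ltnNge; apply/negP=> m_le.
  have : m * t.+1 <= (2 * q.+1).+1 * t.+1 by rewrite leq_mul2r m_le orbT.
  by nia.
Qed.

(** Adding the two inequalities bounds the number of stars below by
(2 n - 2) / (t + 1), which suffices when r <= 1.  When r > 1 it remains to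
exclude 2 q + 1 stars: if a = q - i is the smaller of a and b, then
c >= i (t + 1) + r, which leaves too few stars for the second clique. *)
Lemma kappa_le_isolated a b c : n - 1 <= a * t.+1 + c ->
  n - 1 <= b * t.+1 + c -> kappa_value n t <= a + b + c.
Proof.
wlog ab : a b / a <= b => [wl|] a_ge b_ge.
  have [|/ltnW] := leqP a b => ab; first exact: wl.
  by rewrite (addnC a); apply: wl.
have [q [r [nE lt_r kE]]] := kappa_cases.
have sum_ge : 2 * q * t.+1 + 2 * r <= (a + b + c) * t.+1 by nia.
case: kE => [[r0 ->]|[r1 q0 ->]|[r1 ->]].
- by rewrite -(leq_pmul2r (ltn0Sn t)); nia.
- by rewrite addn1 -(ltn_pmul2r (ltn0Sn t)); nia.
have le1 : 2 * q < a + b + c by rewrite -(ltn_pmul2r (ltn0Sn t)); nia.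
rewrite addn2 ltnNge; apply/negP=> le2.
have mE : a + b + c = (2 * q).+1 by lia.
have aq : a <= q by lia.
have c_ge : (q - a) * t.+1 + r <= c by nia.
have bE : b = q.+1 + (q - a) - c by lia.
move: (q - a) (subnK aq) c_ge bE => i qE c_ge bE.
nia.
Qed.

End Kappa.

(** * The crossed cube *)

(** The matching between the two halves of the crossed cube: pair-related bits
differ by adding the lower bit of the pair to the upper one. *)
Definition twist (s : seq bool) : seq bool :=
  rev (mkseq (fun j => bit s j (+) (odd j && bit s j.-1)) (size s)).

Lemma size_twist s : size (twist s) = size s.
Proof. by rewrite size_rev size_mkseq. Qed.

Lemma bit_twist s j : j < size s ->
  bit (twist s) j = bit s j (+) (odd j && bit s j.-1).
Proof. by move=> lt_js; rewrite {1}/bit revK nth_mkseq. Qed.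

Lemma eq_from_bit s1 s2 : size s1 = size s2 ->
  (forall j, j < size s1 -> bit s1 j = bit s2 j) -> s1 = s2.
Proof.
move=> eq_sz eq_bit; rewrite -[s1]revK -[s2]revK; congr rev.
apply: (@eq_from_nth _ false); rewrite !size_rev //.
Qed.

Lemma twistK : involutive twist.
Proof.
move=> s; apply: eq_from_bit => [|j]; rewrite !size_twist // => lt_js.
rewrite bit_twist ?size_twist // [bit (twist s) j]bit_twist //.
case: j lt_js => [|j] lt_js /=; first by rewrite !addbF.
rewrite bit_twist ?(ltnW lt_js) //.
by case: (odd j); case: (bit s j); case: (bit s j.+1).
Qed.

Lemma bit_cons b s j : j < size s -> bit (b :: s) j = bit s j.
Proof. by move=> lt_js; rewrite /bit rev_cons nth_rcons size_rev lt_js. Qed.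

Lemma pair_relatedE a b c d :
  pair_related (a, b) (c, d) = (d == b) && (c == a (+) b).
Proof. by case: a; case: b; case: c; case: d. Qed.

(** For even dimension the unpaired top bit has even index, so [twist] fixes
it, as the first condition of the crossed cube demands. *)
Lemma CQ_crossE n a b x y : size x = n -> size y = n ->
  CQ_cross n.+1 (a :: x) (b :: y) = (y == twist x).
Proof.
move=> sx sy; rewrite /CQ_cross; apply/idP/eqP.
  case/andP=> top /forallP rel.
  have pairP i : i < n %/ 2 -> bit y (2 * i) = bit x (2 * i) /\
      bit y (2 * i + 1) = bit x (2 * i + 1) (+) bit x (2 * i).
    move=> lt_i.
    have lt_i' : i < (n.+1 - 1) %/ 2 by rewrite subn1.
    have := rel (Ordinal lt_i'); rewrite pair_relatedE /=.
    by rewrite !bit_cons; lia.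
  apply: eq_from_bit => [|j]; rewrite ?size_twist ?sx ?sy // => lt_jn.
  rewrite bit_twist ?sx //.
  have [oj|ej] := boolP (odd j).
    have jE : j = 2 * j./2 + 1 by lia.
    have [|_ odd_bit] := pairP j./2; first by lia.
    by rewrite jE odd_bit addn1.
  rewrite addbF.
  have [lt_j|ge_j] := ltnP j./2 (n %/ 2).
    by have [+ _] := pairP _ lt_j; rewrite (_ : 2 * _ = j) //; lia.
  move: top; rewrite (_ : ~~ odd n.+1) /=; last by lia.
  rewrite (_ : n.+1 - 2 = j); last by lia.
  by rewrite !bit_cons ?sx ?sy // => /eqP.
move=> ->; apply/andP; split.
  apply/implyP => on; rewrite !bit_cons ?size_twist ?sx; try lia.
  rewrite bit_twist ?sx; last by lia.
  by rewrite (_ : odd (n.+1 - 2) = false) ?addbF //; lia.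
apply/forallP=> -[i lt_i] /=.
rewrite pair_relatedE !bit_cons ?size_twist ?sx; try lia.
rewrite !bit_twist ?sx; try lia.
rewrite addn1 /= mul2n odd_double /= !addbF !eqxx //.
Qed.

Fixpoint cube (n : nat) : seq (seq bool) :=
  if n is m.+1 then map (cons false) (cube m) ++ map (cons true) (cube m)
  else [:: [::]].

Lemma mem_cube n s : (s \in cube n) = (size s == n).
Proof.
elim: n s => [|n IHn] [|b s] //=; rewrite mem_cat.
  by apply/norP; split; apply/mapP => -[].
rewrite eqSS -IHn; apply/orP/idP => [[] /mapP[s' ins' [_ ->]] //|ins].
by case: b; [right | left]; apply: map_f.
Qed.

Lemma cube_uniq n : uniq (cube n).
Proof.
elim: n => //= n IHn; rewrite cat_uniq !map_inj_uniq ?IHn ?andbT /=;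
  try by move=> ? ? [].
by apply/hasPn => _ /mapP[s _ ->]; apply/mapP => -[].
Qed.

Lemma size_cube n : size (cube n) = 2 ^ n.
Proof. by elim: n => //= n IHn; rewrite size_cat !size_map IHn expnS; lia. Qed.

Lemma twist_cube n : perm_eq (map twist (cube n)) (cube n).
Proof.
apply: uniq_perm; rewrite ?map_inj_uniq ?cube_uniq //.
  exact: inv_inj twistK.
move=> s; rewrite mem_cube; apply/mapP/idP => [[s' + ->]|ss].
  by rewrite mem_cube size_twist.
by exists (twist s); rewrite ?twistK // mem_cube size_twist.
Qed.

Definition prefix_edge (b : bool) (p : seq bool * seq bool) :=
  (b :: p.1, b :: p.2).

(** Edges in the orientation used for the vertices of the BCDC network: the
lexicographically smaller end comes first. *)
Fixpoint CQ_edges (n : nat) : seq (seq bool * seq bool) :=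
  if n is m.+1 then
    map (prefix_edge false) (CQ_edges m) ++ map (prefix_edge true) (CQ_edges m)
    ++ [seq (false :: x, true :: twist x) | x <- cube m]
  else [::].

Lemma mem_CQ_edgesS n a x b y :
  ((a :: x, b :: y) \in CQ_edges n.+1) =
  if a == b then (x, y) \in CQ_edges n
  else [&& ~~ a, size x == n & y == twist x].
Proof.
rewrite /= !mem_cat; apply/or3P/idP.
  case=> /mapP[].
  - by move=> [x' y'] /= H [-> -> -> ->]; rewrite eqxx.
  - by move=> [x' y'] /= H [-> -> -> ->]; rewrite eqxx.
  - by move=> x' /= + [-> -> -> ->]; rewrite mem_cube /= eqxx andbT.
case: eqP => [<- H|].
  case: a; [apply: Or32 | apply: Or31]; apply/mapP;
  by exists (x, y).
case: a b => -[] //= _ /andP[sx /eqP->]; apply: Or33.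
by apply/mapP; exists x; rewrite ?mem_cube.
Qed.

Lemma mem_CQ_edges_size n p : p \in CQ_edges n ->
  size p.1 = n /\ size p.2 = n.
Proof.
elim: n p => // n IHn p; rewrite /= !mem_cat.
case/or3P=> /mapP[q + ->] /=.
- by case/IHn=> -> ->.
- by case/IHn=> -> ->.
- by rewrite mem_cube size_twist => /eqP ->.
Qed.

Lemma CQ_edgesS_inv n p : p \in CQ_edges n.+1 ->
  exists a x b y, p = (a :: x, b :: y).
Proof.
case/mem_CQ_edges_size; case: p => -[|a x] [|b y] //= _ _.
by exists a, x, b, y.
Qed.

Lemma CQ_edges_uniq n : uniq (CQ_edges n).
Proof.
have pI b : injective (prefix_edge b) by move=> [? ?] [? ?] [-> ->].
elim: n => //= n IHn; rewrite !cat_uniq !map_inj_uniq ?cube_uniq ?IHn //=;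
  last by move=> ? ? [->].
rewrite andbT; apply/andP; split; last first.
  by apply/hasPn => _ /mapP[s _ ->]; apply/mapP => -[].
apply/hasPn => p; rewrite mem_cat => /orP[] /mapP[s _ ->]; apply/mapP => -[] //.
Qed.

Definition CQ_link (n : nat) : rel (seq bool) :=
  fun x y => ((x, y) \in CQ_edges n) || ((y, x) \in CQ_edges n).

Lemma CQ_linkS n a x b y :
  CQ_link n.+1 (a :: x) (b :: y) =
  if a == b then CQ_link n x y else (size x == n) && (y == twist x).
Proof.
rewrite /CQ_link !mem_CQ_edgesS (eq_sym b a); case: eqP => // /eqP.
have tw : (size y == n) && (x == twist y) = (size x == n) && (y == twist x).
  by apply/andP/andP=> -[/eqP sz /eqP->]; rewrite size_twist twistK sz !eqxx.
by case: a b => -[] //= _; rewrite ?tw ?orbF //.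
Qed.

Lemma CQ_link_size n x y : CQ_link n x y -> size x = n /\ size y = n.
Proof. by case/orP=> /mem_CQ_edges_size[]. Qed.

Lemma CQ_link_irr n : irreflexive (CQ_link n).
Proof.
elim: n => // n IHn [|a x]; first by apply/negP=> /CQ_link_size[].
by rewrite CQ_linkS eqxx.
Qed.

(** Along the recursion an edge between the halves always starts in the half
labelled 0. *)
Lemma CQ_edges_asym n x y :
  (x, y) \in CQ_edges n -> (y, x) \in CQ_edges n -> False.
Proof.
elim: n x y => // n IHn x y xy; have [a [x' [b [y' [? ?]]]]] := CQ_edgesS_inv xy.
subst x y.
move: xy; rewrite !mem_CQ_edgesS (eq_sym b); case: (eqVneq a b) => [_|nab].
  exact: IHn.
by case: a b nab => -[].
Qed.

(** A triangle not contained in one half would have two vertices in one half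
with the same partner in the other, but the cross edges form a matching. *)
Lemma CQ_link_triangle_free n x y z :
  CQ_link n x y -> CQ_link n y z -> ~~ CQ_link n x z.
Proof.
elim: n x y z => // n IHn x y z xy yz; apply/negP=> xz.
have [sx sy] := CQ_link_size xy; have [_ sz] := CQ_link_size yz.
case: x y z sx sy sz xy yz xz => [|a x] [|b y] [|c z] //= _ _ _.
rewrite !CQ_linkS.
have [<-|nab] := eqVneq a b.
  have [_|_] := eqVneq a c; first by move=> /IHn /[apply] /negPf->.
  move=> xy /andP[_ /eqP->] /andP[_ /eqP/(inv_inj twistK) yx].
  by move: xy; rewrite yx CQ_link_irr.
case/andP=> _ /eqP->; have [<-|nbc] := eqVneq b c.
  rewrite (negPf nab) => yz /andP[_ /eqP zE].
  by move: yz; rewrite zE CQ_link_irr.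
have -> : a == c by case: a b c nab nbc => -[] [].
by case/andP=> _ /eqP->; rewrite twistK CQ_link_irr.
Qed.

Definition incident (x : seq bool) (p : seq bool * seq bool) : bool :=
  (x == p.1) || (x == p.2).

Lemma CQ_regular n x : size x = n -> count (incident x) (CQ_edges n) = n.
Proof.
elim: n x => [|n IHn] [|b x] //= [sx].
rewrite !count_cat !count_map.
have same c : count (preim (prefix_edge c) (incident (b :: x))) (CQ_edges n)
              = (b == c) * n.
  case: eqP => [->|nbc]; [rewrite mul1n -[RHS](IHn x sx)|rewrite mul0n].
    by apply: eq_count => p; rewrite /= /incident !eqseq_cons eqxx.
  apply/eqP; rewrite -leqn0 leqNgt -has_count; apply/hasPn => p _ /=.
  by rewrite /incident !eqseq_cons; case: eqP.
rewrite !same.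
suff -> : count (preim (fun y => (false :: y, true :: twist y))
                   (incident (b :: x))) (cube n) = 1 by case: b {same}; lia.
have once y : size y = n -> count (pred1 y) (cube n) = 1.
  by move=> sy; rewrite count_uniq_mem ?cube_uniq // mem_cube sy eqxx.
case: b {same}; [rewrite -(once (twist x)) ?size_twist //|rewrite -(once x) //].
  apply: eq_count => y; rewrite /= /incident !eqseq_cons /=.
  by apply/eqP/eqP => ->; rewrite twistK.
by apply: eq_count => y; rewrite /= /incident !eqseq_cons /= orbF eq_sym.
Qed.

(** Explicit in dimension 2, and preserved by prefixing zeros. *)
Lemma CQ_4cycle n : 2 <= n -> exists u v w z,
  [/\ uniq [:: u; v; w; z], (u, v) \in CQ_edges n, (w, z) \in CQ_edges n,
      (u, w) \in CQ_edges n & (v, z) \in CQ_edges n].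
Proof.
elim: n => // -[|[|n]] IHn // _.
  by exists [:: false; false], [:: false; true], [:: true; false],
    [:: true; true].
have [//|u [v [w [z [uq uv wz uw vz]]]]] := IHn.
exists (false :: u), (false :: v), (false :: w), (false :: z).
have consI : injective (cons false) by move=> ? ? [].
rewrite -(map_inj_uniq consI) in uq.
by split=> //; rewrite mem_CQ_edgesS eqxx.
Qed.

(** * Edge isoperimetry in the crossed cube *)

Definition boundary (n : nat) (A : pred (seq bool)) : nat :=
  count (fun p => A p.1 != A p.2) (CQ_edges n).

Definition sub_cube (b : bool) (A : pred (seq bool)) : pred (seq bool) :=
  fun x => A (b :: x).

Lemma count_cubeS n A :
  count A (cube n.+1) =
  count (sub_cube false A) (cube n) + count (sub_cube true A) (cube n).
Proof. by rewrite /= count_cat !count_map. Qed.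

(** The matching sends the trace of A on one half onto a set of the same size
in the other half, so at least the difference of the sizes of the two traces
is the number of cross edges in the boundary. *)
Lemma boundaryS n A (a := count (sub_cube false A) (cube n))
    (b := count (sub_cube true A) (cube n)) :
  boundary n (sub_cube false A) + boundary n (sub_cube true A)
    + ((a - b) + (b - a)) <= boundary n.+1 A.
Proof.
rewrite /boundary [CQ_edges n.+1]/= !count_cat !count_map [leqRHS]addnA.
apply: (leq_add (leqnn _)).
have bE : b = count (sub_cube true A \o twist) (cube n).
  by rewrite -count_map; apply/permP; rewrite perm_sym twist_cube.
rewrite bE /a {a b bE}; set P := sub_cube false A; set Q := _ \o twist.
rewrite [leqRHS](_ : _ = count (fun x => P x != Q x) (cube n)) //.
by elim: (cube n) => //= x s; case: (P x); case: (Q x) => /=; lia.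
Qed.

Lemma count_cube_le n A : count A (cube n) <= 2 ^ n.
Proof. by rewrite -size_cube count_size. Qed.

(** Bounds for the size d of the boundary of a set of k among M = 2 ^ n
vertices, invariant under the step from n to n + 1 for n >= 3.  The extra
alternative is a 4-cycle in dimension 3, whose boundary has 4 < 3 n - 4
edges. *)
Definition cut_profile (n M k d : nat) : Prop :=
  [\/ k = 0 \/ k = M,
      (k = 1 \/ k = M - 1) /\ n <= d,
      (k = 2 \/ k = M - 2) /\ 2 * n - 2 <= d
    | 2 < k < M - 2 /\ (3 * n - 4 <= d \/ n = 3 /\ k = 4 /\ 4 <= d)].

(** The numbers a and b are the sizes of the traces on the two halves.  If
one trace is empty or full, the other contributes its own boundary and one
cross edge for each of its vertices inside, or respectively outside, the set.
Otherwise both traces have a boundary, and cross edges are needed only if one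
of the traces or its complement is a single vertex. *)
Lemma cut_profile_step n M a b da db d :
  2 < n -> 3 * n - 1 <= M -> 
  cut_profile n M a da -> cut_profile n M b db -> 
  a <= M -> b <= M -> da + db + ((a - b) + (b - a)) <= d ->
  cut_profile n.+1 (2 * M) (a + b) d.
Proof.
move=> n_ge M_ge pa pb aM bM d_ge.
have kP : [\/ a + b = 0 \/ a + b = 2 * M, a + b = 1 \/ a + b = 2 * M - 1,
             a + b = 2 \/ a + b = 2 * M - 2 | 2 < a + b < 2 * M - 2].
  have [|[|[|]]] : (a + b = 0 \/ a + b = 2 * M) \/
    (a + b = 1 \/ a + b = 2 * M - 1) \/ (a + b = 2 \/ a + b = 2 * M - 2)
    \/ 2 < a + b < 2 * M - 2 by lia.
  - by constructor 1.
  - by constructor 2.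
  - by constructor 3.
  - by constructor 4.
case: kP => kE; [by constructor 1|constructor 2|constructor 3|constructor 4];
  (split; first by exact: kE); [| |left];
  move: pa pb;
  case=> [pa|[pa da_ge]|[pa da_ge]|[pa da_ge]];
     case=> [pb|[pb db_ge]|[pb db_ge]|[pb db_ge]].
all: lia.
Qed.

(** The induction starts at n = 3, where the profile follows from the exact
bounds in dimensions 1 and 2. *)
Lemma boundary_profile n A : 2 < n ->
  cut_profile n (2 ^ n) (count A (cube n)) (boundary n A).
Proof.
have pow_ge m : 3 * m.+3 - 1 <= 2 ^ m.+3.
  by elim: m => // m; rewrite [2 ^ m.+4]expnS; lia.
case: n => // -[//|[//|n]] _.
elim: n A => [|n IHn] A.
  have d1 B : (count B (cube 1) == 1) <= boundary 1 B.
    have := boundaryS 0 B; have := count_cubeS 0 B.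
    have := count_cube_le 0 (sub_cube false B).
    have := count_cube_le 0 (sub_cube true B); lia.
  have d2 B : 2 * (0 < count B (cube 2) < 4) <= boundary 2 B.
    have := boundaryS 1 B; have := count_cubeS 1 B.
    have := count_cube_le 1 (sub_cube false B).
    have := count_cube_le 1 (sub_cube true B).
    have := d1 (sub_cube false B); have := d1 (sub_cube true B); lia.
  have := boundaryS 2 A; have := count_cubeS 2 A.
  have := count_cube_le 2 (sub_cube false A).
  have := count_cube_le 2 (sub_cube true A).
  have := d2 (sub_cube false A); have := d2 (sub_cube true A).
  move: (count A _) (boundary 3 A) => k d *.
  have [kE'|[kE'|[kE'|kE']]] : (k = 0 \/ k = 8) \/ (k = 1 \/ k = 7) \/
    (k = 2 \/ k = 6) \/ 2 < k < 6 by lia.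
  - by constructor 1; lia.
  - by constructor 2; lia.
  - by constructor 3; lia.
  - by constructor 4; lia.
rewrite count_cubeS expnS; apply: cut_profile_step (boundaryS _ _) => //.
- exact: count_cube_le.
- exact: count_cube_le.
Qed.

Lemma boundary_ge n A : 3 < n ->
  2 < count A (cube n) -> 2 < count (predC A) (cube n) ->
  3 * n - 4 <= boundary n A.
Proof.
move=> n_ge A_ge C_ge; have := count_predC A (cube n); rewrite size_cube.
by case: (boundary_profile A (ltnW n_ge)); lia.
Qed.

(** * The BCDC network as the line graph of the crossed cube *)

Definition share_end (p q : seq bool * seq bool) : bool :=
  incident p.1 q || incident p.2 q.

Lemma BCDC_vertexE n p : 1 < n -> size p.1 = n -> size p.2 = n ->
  BCDC_vertex n p = (p \in CQ_edges n).
Proof.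
case: n => // -[|n] // _.
elim: n p => [|n IHn] [[|a x] [|b y]] // [sx] [sy].
  by case: x y sx sy a b => [|a' []] // [|b' []] // _ _; 
     case: a' b' => -[] -[] -[].
rewrite mem_CQ_edgesS sx eqxx /=.
by case: a b => -[] //=; rewrite -?IHn // CQ_crossE.
Qed.

Lemma share_end_cons b p q :
  share_end (prefix_edge b p) (prefix_edge b q) = share_end p q.
Proof. by rewrite /share_end /incident /= ?eqseq_cons !eqxx. Qed.

(** Two cross edges sharing an end would be equal, because they form a
matching; this is why the set S_n of the recursive definition is
independent. *)
Lemma BCDC_relE n p q : 1 < n -> p \in CQ_edges n -> q \in CQ_edges n ->
  BCDC_rel n p q = (p != q) && share_end p q.
Proof.
case: n => // -[|n] // _.
elim: n p q => [|n IHn] p q.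
  by move=> _ _; rewrite /share_end /incident /= !orbA. 
have pI b : injective (prefix_edge b) by move=> [? ?] [? ?] [-> ->].
rewrite [CQ_edges n.+3]/= -/(CQ_edges n.+2) !mem_cat.
case/or3P=> /mapP[p' p'E ->]; case/or3P=> /mapP[q' q'E ->].
- by rewrite (inj_eq (pI _)) share_end_cons -IHn //; case: p' q' {p'E q'E} => ? ? [].
- by rewrite /share_end /incident /= ?eqseq_cons /= ?andbF.
- rewrite /share_end /incident /= ?xpair_eqE ?eqseq_cons /= ?andbF ?orbF.
  by case: p' {p'E}.
- by rewrite /share_end /incident /= ?eqseq_cons /= ?andbF.
- by rewrite (inj_eq (pI _)) share_end_cons -IHn //; case: p' q' {p'E q'E} => ? ? [].
- rewrite /share_end /incident /= ?xpair_eqE ?eqseq_cons /=.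
  by case: p' {p'E}.
- rewrite /share_end /incident /= ?xpair_eqE ?eqseq_cons /= ?andbF ?orbF.
  by case: q' {q'E} => ? ? /=; rewrite ![p' == _]eq_sym.
- rewrite /share_end /incident /= ?xpair_eqE ?eqseq_cons /=.
  by case: q' {q'E} => ? ? /=; rewrite ![twist p' == _]eq_sym.
- rewrite /share_end /incident /= ?xpair_eqE ?eqseq_cons /= ?andbF ?orbF.
  by rewrite (inj_eq (inv_inj twistK)) orbb andbb andNb.
Qed.

Lemma incident_link n p x y : p \in CQ_edges n ->
  incident x p -> incident y p -> x != y -> CQ_link n x y.
Proof.
case: p => a b abE; rewrite /CQ_link.
by case/orP=> /eqP-> /orP[] /eqP->; rewrite /= ?eqxx // abE ?orbT.
Qed.

Lemma incident_eq n p q x y : p \in CQ_edges n -> q \in CQ_edges n ->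
  incident x p -> incident y p -> incident x q -> incident y q ->
  x != y -> p = q.
Proof.
case: p q => [a b] [c d] pE qE.
rewrite /incident /= => /orP[] /eqP ? /orP[] /eqP ? /orP[] /eqP ? /orP[] /eqP ?;
  subst; rewrite ?eqxx // => _; by case: (CQ_edges_asym pE qE).
Qed.

Lemma share_endP p q :
  reflect (exists2 x, incident x p & incident x q) (share_end p q).
Proof.
apply: (iffP orP) => [[pq|pq]|[x /orP[] /eqP->]]; try by [left | right].
  by exists p.1; rewrite // /incident eqxx.
by exists p.2; rewrite // /incident eqxx orbT.
Qed.

Section LineGraph.
Variable n : nat.
Hypothesis n_gt1 : 1 < n.

Definition ends (p : BCDC n) : seq bool * seq bool :=
  (tval (val p).1, tval (val p).2).

Lemma ends_inj : injective ends.
Proof.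
by move=> [[x y] p] [[x' y'] q] [/= /val_inj xE /val_inj yE];
   apply: val_inj; rewrite /= xE yE.
Qed.

Lemma ends_edge p : ends p \in CQ_edges n.
Proof. by rewrite -BCDC_vertexE ?size_tuple //; exact: (valP p). Qed.

Lemma ends_onto q : q \in CQ_edges n -> exists p, ends p = q.
Proof.
case: q => x y qE; have [/= /eqP sx /eqP sy] := mem_CQ_edges_size qE.
have pV : BCDC_vertex n (tval (Tuple sx, Tuple sy).1, tval (Tuple sx, Tuple sy).2).
  by rewrite BCDC_vertexE // size_tuple.
by exists (Sub (Tuple sx, Tuple sy) pV).
Qed.

Lemma card_ends (P : pred (seq bool * seq bool)) :
  #|[set p | P (ends p)]| = count P (CQ_edges n).
Proof.
have perm : perm_eq (map ends (enum (BCDC n))) (CQ_edges n).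
  apply: uniq_perm; rewrite ?CQ_edges_uniq ?(map_inj_uniq ends_inj) ?enum_uniq //.
  move=> q; apply/mapP/idP => [[p _ ->]|/ends_onto[p <-]]; first exact: ends_edge.
  by exists p; rewrite ?mem_enum.
rewrite -(permP perm) count_map enumT cardE /enum_mem size_filter.
by apply: eq_count => p; rewrite !inE.
Qed.

Lemma BCDC_adjE (p q : BCDC n) :
  sadj p q = (p != q) && share_end (ends p) (ends q).
Proof.
have -> : (p != q) = (ends p != ends q).
  by congr negb; apply/eqP/eqP => [->|/ends_inj].
by rewrite -(BCDC_relE n_gt1 (ends_edge p) (ends_edge q)).
Qed.

Definition edges_at (x : seq bool) : {set BCDC n} := [set p | incident x (ends p)].

Lemma card_edges_at x : size x = n -> #|edges_at x| = n.
Proof. by move=> sx; rewrite card_ends CQ_regular. Qed.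

Lemma edges_at_clique x : {in edges_at x &, forall p q, p != q -> sadj p q}.
Proof.
move=> p q; rewrite !inE => px qx npq; rewrite BCDC_adjE npq.
by apply/share_endP; exists x.
Qed.

Lemma ends_eq p q x y : incident x (ends p) -> incident y (ends p) ->
  incident x (ends q) -> incident y (ends q) -> x != y -> p = q.
Proof.
move=> xp yp xq yq nxy; apply: ends_inj.
exact: (incident_eq (ends_edge p) (ends_edge q) xp yp xq yq).
Qed.

Lemma ends_link p x y :
  incident x (ends p) -> incident y (ends p) -> x != y -> CQ_link n x y.
Proof. exact: incident_link (ends_edge p). Qed.

Section Edge.
Variable e : BCDC n.

Lemma end1_incident : incident (ends e).1 (ends e).
Proof. by rewrite /incident eqxx. Qed.

Lemma end2_incident : incident (ends e).2 (ends e).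
Proof. by rewrite /incident eqxx orbT. Qed.

Lemma ends_neq : (ends e).1 != (ends e).2.
Proof.
apply/eqP=> eqE; have := CQ_link_irr n (ends e).1.
by rewrite /CQ_link {2 4}eqE -surjective_pairing ends_edge.
Qed.

Lemma size_ends : size (ends e).1 = n /\ size (ends e).2 = n.
Proof. exact: mem_CQ_edges_size (ends_edge e). Qed.

Definition side1 := edges_at (ends e).1 :\ e.
Definition side2 := edges_at (ends e).2 :\ e.

Lemma card_sides : #|side1| = n - 1 /\ #|side2| = n - 1.
Proof.
have [s1 s2] := size_ends; rewrite /side1 /side2.
have := cardsD1 e (edges_at (ends e).1); have := cardsD1 e (edges_at (ends e).2).
by rewrite !card_edges_at // !inE end1_incident end2_incident; lia.
Qed.

Lemma nbr_sides : nbr e = side1 :|: side2.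
Proof.
by apply/setP=> p; rewrite !inE BCDC_adjE /share_end -andb_orr eq_sym.
Qed.

(** Edges at the two ends of e are neither equal nor adjacent: a common end
would close a double edge or a triangle with e. *)
Lemma sides_disjoint x y p q : x != y ->
  incident x (ends e) -> incident y (ends e) ->
  p != e -> incident x (ends p) -> q != e -> incident y (ends q) ->
  (q != p) && ~~ sadj p q.
Proof.
move=> nxy xe ye npe xp nqe yq; have npq : q != p.
  by apply: contraNneq npe => qE; rewrite qE in yq; apply/eqP; apply: (ends_eq xp yq).
rewrite npq BCDC_adjE eq_sym npq /=; apply/share_endP=> -[z zp zq].
have [xz|nxz] := eqVneq x z.
  by rewrite -xz in zq; case/eqP: nqe; apply: (ends_eq zq yq).
have [yz|nyz] := eqVneq y z.
  by rewrite -yz in zp; case/eqP: npe; apply: (ends_eq xp zp).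
have := CQ_link_triangle_free (ends_link xp zp nxz) (ends_link zq yq _).
by rewrite eq_sym nyz (ends_link xe ye nxy) => /(_ isT).
Qed.

End Edge.

Lemma card_nbr (e : BCDC n) : #|nbr e| = 2 * n - 2.
Proof.
rewrite nbr_sides cardsU; have [-> ->] := card_sides e.
rewrite (_ : #|_ :&: _| = 0); first by lia.
apply: eq_card0 => p; rewrite !inE; apply/negP.
case/andP=> /andP[npe p1] /andP[_ p2].
have := sides_disjoint (ends_neq e) (end1_incident e) (end2_incident e)
  npe p1 npe p2.
by rewrite eqxx.
Qed.

(** Two edges at x that meet c in different ends would form a triangle with
c. *)
Lemma card_nbr_edges_at x (c : BCDC n) : ~~ incident x (ends c) ->
  #|nbr c :&: edges_at x| <= 1.
Proof.
move=> xc; apply/card_le1_eqP => p q; rewrite !inE !BCDC_adjE.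
case/andP=> /andP[_ /share_endP[y yc yp]] xp /andP[/andP[_ /share_endP[z zc zq]] xq].
have nxy : x != y by apply: contraNneq xc => ->.
have nxz : x != z by apply: contraNneq xc => ->.
have [yz|nyz] := eqVneq y z.
  by rewrite -yz in zq; apply: (ends_eq xq zq xp yp).
have := CQ_link_triangle_free (ends_link xp yp nxy) (ends_link yc zc nyz).
by rewrite (ends_link xq zq nxz).
Qed.

Lemma isolating_cover t (e : BCDC n) (F : {set subgraph (BCDC n)}) :
  (forall S, S \in F -> starlike t (sub_vertices S)) -> e \notin removed F ->
  nbr e \subset removed F ->
  exists a b c, [/\ a + b + c = #|F|, n - 1 <= a * t.+1 + c
                  & n - 1 <= b * t.+1 + c].
Proof.
have [<- s2E] := card_sides e; rewrite -{2}s2E nbr_sides.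
apply: two_cliques_cover => c.
- case/setD1P=> nce; rewrite inE => c1; rewrite disjoint_subset.
  apply/subsetP=> q; rewrite !inE => cq; apply/negP=> /andP[nqe q2].
  have := sides_disjoint (ends_neq e) (end1_incident e) (end2_incident e)
    nce c1 nqe q2.
  by case/orP: cq => ->; rewrite ?andbF.
- case/setD1P=> nce; rewrite inE => c2; rewrite disjoint_subset.
  apply/subsetP=> q; rewrite !inE => cq; apply/negP=> /andP[nqe q1].
  have := sides_disjoint _ (end2_incident e) (end1_incident e)
    nce c2 nqe q1.
  by rewrite eq_sym ends_neq => /(_ isT); case/orP: cq => ->; rewrite ?andbF.
move=> nce; rewrite !inE nce /= => c1 c2.
split; [apply: leq_trans (card_nbr_edges_at c1)
       | apply: leq_trans (card_nbr_edges_at c2)];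
  by apply: subset_leq_card; apply: setIS; apply: subsetDl.
Qed.

End LineGraph.

(** * Disconnected remainders *)

Lemma count_ge_uniq (s : seq (seq bool)) n (A : pred (seq bool)) :
  uniq s -> {in s, forall x, size x = n /\ A x} -> size s <= count A (cube n).
Proof.
move=> us sA; rewrite -size_filter; apply: uniq_leq_size => // x /sA[sx Ax].
by rewrite mem_filter Ax mem_cube sx eqxx.
Qed.

(** If e has a surviving neighbour p, then p has an end that is not an end of
e; with the two ends of e this makes three elements of A. *)
Lemma closed_side n (A : pred (seq bool)) (e : BCDC n) (D : {set BCDC n}) :
  1 < n -> e \notin D ->
  (forall p, p \notin D -> (p == e) || sadj e p ->
     A (ends p).1 /\ A (ends p).2) ->
  nbr e \subset D \/ 2 < count A (cube n).
Proof.
move=> n1 eD clA; have [|/subsetPn[p]] := boolP (nbr e \subset D); first by left.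
rewrite inE => ep pD; right.
have [A1 A2] := clA e eD (introT orP (or_introl (eqxx e))).
have [B1 B2] := clA p pD (introT orP (or_intror ep)).
have [s1 s2] := size_ends n1 e; have [r1 r2] := size_ends n1 p.
move: ep; rewrite (BCDC_adjE n1) => /andP[nep _].
have third z : incident z (ends p) -> A z -> size z = n ->
    ~~ incident z (ends e) -> 2 < count A (cube n).
  move=> _ Az sz nze.
  apply: (@count_ge_uniq [:: z; (ends e).1; (ends e).2]).
    by rewrite /= !inE nze ends_neq.
  by move=> x; rewrite !inE => /or3P[] /eqP->.
have [i1|n1'] := boolP (incident (ends p).1 (ends e)); last first.
  by apply: third n1' => //; exact: end1_incident.
have [i2|n2'] := boolP (incident (ends p).2 (ends e)); last first.
  by apply: third n2' => //; exact: end2_incident.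
case/eqP: nep; apply: (ends_eq n1 i1 i2); rewrite ?ends_neq //.
  exact: end1_incident.
exact: end2_incident.
Qed.

(** The side A below collects the ends of the edges connected to x.  An edge
with one end in A either belongs to the component of x, and then both its ends
are in A, or is removed; so the boundary of A is removed, and y lies on the
other side.  The lemma [closed_side] applies to both sides. *)
Lemma cut_isolates_or_large n (F : {set subgraph (BCDC n)}) :
  3 < n -> subgraph_cut F ->
  (exists e, e \notin removed F /\ nbr e \subset removed F) \/
  3 * n - 4 <= #|removed F|.
Proof.
move=> n3; have n1 : 1 < n by lia.
rewrite /subgraph_cut -/(removed F); set D := removed F.
have inD (z : induced (~: D)) : val z \notin D by have := valP z; rewrite inE.
case/orP=> [/existsP[x /existsP[y ncon]]|/card1P[x only]]; last first.
  left; exists (val x); split; first exact: inD.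
  apply/subsetP=> p; rewrite inE => xp; apply/negPn/negP => pD.
  have pD' : p \in ~: D by rewrite inE.
  have := only (Sub p pD' : induced (~: D)).
  rewrite !inE => /esym/eqP/(congr1 val) /= px.
  have pE : p = val x := px.
  by rewrite pE sadj_irr in xp.
pose con := connect (@sadj (induced (~: D))).
have conS z (w : BCDC n) : w \notin D -> con x z ->
    (w == val z) || sadj (val z) w ->
    exists2 w' : induced (~: D), val w' = w & con x w'.
  move=> wD xz zw; have wD' : w \in ~: D by rewrite inE.
  exists (Sub w wD'); first exact: SubK.
  case/orP: zw => [/eqP zw|zw].
    by rewrite (_ : Sub w wD' = z) //; apply: val_inj.
  exact: connect_trans xz (connect1 _).
pose A s := [exists z : induced (~: D), con x z && incident s (ends (val z))].
have closed p s : p \notin D -> incident s (ends p) -> A s ->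
    exists2 w : induced (~: D), val w = p & con x w.
  move=> pD sp /existsP[z /andP[xz sz]]; apply: conS pD xz _.
  rewrite (BCDC_adjE n1) (eq_sym p); case: eqP => //= _.
  by apply/share_endP; exists s.
have [xN|A_ge] : nbr (val x) \subset D \/ 2 < count A (cube n).
  apply: closed_side => // p pD xp.
  have [w wE xw] := conS x p pD (connect0 _ _) xp.
  by split; apply/existsP; exists w; rewrite wE xw ?end1_incident ?end2_incident.
  by left; exists (val x).
have [yN|C_ge] : nbr (val y) \subset D \/ 2 < count (predC A) (cube n).
  apply: closed_side => // p pD yp.
  have noA s : incident s (ends p) -> ~~ A s.
    move=> sp; apply/negP=> /(closed p s pD sp)[w wE xw].
    have [|y' /val_inj yE xy] := conS w (val y) (inD y) xw.
      by rewrite wE eq_sym sadj_sym.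
    by rewrite -/con -yE xy in ncon.
  by split; apply: noA; rewrite ?end1_incident ?end2_incident.
  by left; exists (val y).
right; apply: leq_trans (boundary_ge n3 A_ge C_ge) _.
rewrite /boundary -(card_ends n1); apply: subset_leq_card.
apply/subsetP=> p; rewrite inE => nA; apply/negPn/negP => pD.
have A12 : A (ends p).1 = A (ends p).2.
  apply/idP/idP => Ap.
    have [w wE xw] := closed _ _ pD (end1_incident _) Ap.
    by apply/existsP; exists w; rewrite xw wE end2_incident.
  have [w wE xw] := closed _ _ pD (end2_incident _) Ap.
  by apply/existsP; exists w; rewrite xw wE end1_incident.
by rewrite A12 eqxx in nA.
Qed.

(** * Lower and upper bounds *)

Lemma kappa_lower n t (F : {set subgraph (BCDC n)}) :
  4 <= n -> 2 <= t <= 2 * n - 3 -> subgraph_cut F ->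
  (forall S, S \in F -> starlike t (sub_vertices S)) ->
  kappa_value n t <= #|F|.
Proof.
move=> hn ht cutF starF; have n1 : 1 < n by lia.
case: (cut_isolates_or_large hn cutF) => [[e [eF nF]]|big].
  have [a [b [c [<- a_ge b_ge]]]] := isolating_cover n1 starF eF nF.
  exact: kappa_le_isolated.
apply: kappa_le_spread => //; apply: leq_trans big _.
rewrite -[removed F]setIT; apply: leq_trans (card_removedI _ _) _.
rewrite -sum_nat_const; apply: leq_sum => S SF; rewrite setIT.
by have [c []] := starF S SF.
Qed.

(** With remainder 1, the edges p and q of the 4-cycle are left out of the
two clique covers, and one star centred at the opposite edge c covers both. *)
Lemma kappa_upper n t :
  4 <= n -> 2 <= t <= 2 * n - 3 ->
  exists2 F : {set subgraph (BCDC n)}, structure_cut (star t) F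
    & #|F| <= kappa_value n t.
Proof.
move=> hn ht; have n1 : 1 < n by lia.
have [u [v [w [z [uq uvE wzE uwE vzE]]]]] := CQ_4cycle n1.
have [[e eE] [c cE]] := (ends_onto n1 uvE, ends_onto n1 wzE).
have [[p pE] [q qE]] := (ends_onto n1 uwE, ends_onto n1 vzE).
move: uq; rewrite /= !inE !negb_or => /and4P[/and3P[nuv nuw nuz] /andP[nvw nvz] nwz _].
have deg x : x != e -> t <= #|nbr x :\ e|.
  move=> _; have := card_nbr n1 x; rewrite (cardsD1 e).
  by move: #|_| (e \in _) => m b; clear - ht; lia.
have cut F : star_family t e F -> nbr e \subset removed F -> structure_cut (star t) F.
  move=> famF nF; split=> [|S /famF[]//]; apply: isolated_cut nF.
  by apply/bigcupP=> -[S /famF[_ /negP eS]] /eS.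
have cover x (X : {set BCDC n}) : X \subset edges_at n x :\ e ->
    exists F : {set subgraph (BCDC n)}, [/\ star_family t e F,
      X \subset removed F & #|F| <= ceil_divn #|X| t.+1].
  move=> /subsetP Xx; apply: clique_cover.
  - by apply/negP=> /Xx; rewrite !inE eqxx.
  - by move=> a b /Xx/setD1P[_ ax] /Xx/setD1P[_ bx]; apply: edges_at_clique ax bx.
  - by move=> a /Xx/setD1P[nae _]; apply: deg.
have famU F1 F2 : star_family t e F1 -> star_family t e F2 -> star_family t e (F1 :|: F2).
  by move=> fam1 fam2 S /setUP[/fam1|/fam2].
have [c1 c2] := card_sides n1 e.
have neE (a b : BCDC n) : ends a != ends b -> a != b.
  by apply: contraNneq => ->.
have npe : p != e by apply: neE; rewrite pE eE xpair_eqE eqxx eq_sym.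
have nqe : q != e by apply: neE; rewrite qE eE xpair_eqE eq_sym (negPf nuv).
have nec : e != c by apply: neE; rewrite eE cE xpair_eqE (negPf nuw).
have pN : p \in side1 e by rewrite !inE npe eE pE /incident eqxx.
have qN : q \in side2 e by rewrite !inE nqe eE qE /incident eqxx.
rewrite /kappa_value; case: ifP => [/andP[_ /eqP r1]|_]; last first.
  have [F1 [fam1 N1F F1c]] := cover (ends e).1 (side1 e) (subxx _).
  have [F2 [fam2 N2F F2c]] := cover (ends e).2 (side2 e) (subxx _).
  exists (F1 :|: F2).
    apply: cut; first exact: famU.
    by rewrite nbr_sides // /removed bigcup_setU setUSS.
  rewrite c1 c2 in F1c F2c.
  rewrite cardsU mul2n -addnn; apply: leq_trans (leq_subr _ _) _.
  exact: leq_add.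
have [F1 [fam1 N1F F1c]] := cover (ends e).1 (side1 e :\ p) (subD1set _ _).
have [F2 [fam2 N2F F2c]] := cover (ends e).2 (side2 e :\ q) (subD1set _ _).
have [|| S [isoS /subUsetP[_ XS] eS]] := @star_avoiding _ t e c [set p; q] nec.
- apply/subsetP=> x; rewrite !inE => /orP[] /eqP->.
    rewrite npe (BCDC_adjE n1) neE /=; last first.
      by rewrite cE pE xpair_eqE eq_sym (negPf nuw).
    by apply/share_endP; exists w; rewrite ?cE ?pE /incident eqxx ?orbT.
  rewrite nqe (BCDC_adjE n1) neE /=; last first.
    by rewrite cE qE xpair_eqE eq_sym (negPf nvw).
  by apply/share_endP; exists z; rewrite ?cE ?qE /incident eqxx ?orbT.
- case/andP: (ht) => t_ge2 _; rewrite deg 1?eq_sym // andbT cards2.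
  by apply: leq_trans t_ge2; rewrite ltnS leq_b1.
exists (S |: (F1 :|: F2)).
  apply: cut; first by move=> S' /setU1P[->|] //; apply: famU.
  rewrite nbr_sides // /removed !bigcup_setU big_set1.
  apply/subsetP=> x /setUP[x1|x2]; rewrite in_setU in_setU.
    have [->|nxp] := eqVneq x p; first by rewrite (subsetP XS) // !inE eqxx.
    by apply/or3P/Or32/(subsetP N1F); rewrite in_setD1 nxp.
  have [->|nxq] := eqVneq x q; first by rewrite (subsetP XS) // !inE eqxx orbT.
  by apply/or3P/Or33/(subsetP N2F); rewrite in_setD1 nxq.
have := cardsD1 p (side1 e); have := cardsD1 q (side2 e).
rewrite c1 c2 pN qN => cq cp.
have nE := divn_eq (n - 1) (1 + t); rewrite r1 in nE.
move: F1c F2c; set k := (n - 1) %/ (1 + t) in nE *.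
have -> : #|side1 e :\ p| = k * t.+1 by clear - nE cp; lia.
have -> : #|side2 e :\ q| = k * t.+1 by clear - nE cq; lia.
rewrite {1 2}/ceil_divn dvdn_mull // addn0 mulnK // => F1c F2c.
have -> : 2 * n - 4 = 2 * k * (1 + t) by clear - nE; lia.
rewrite mulnK // cardsU1 addnC; apply: leq_add; last exact: leq_b1.
rewrite cardsU mul2n -addnn; apply: leq_trans (leq_subr _ _) _.
exact: leq_add.
Qed.

Theorem theorem4p8 (n t : nat) (hn : 4 <= n) (ht : 2 <= t <= 2 * n - 3) :
  let r := (n - 1) %% (1 + t) in
  let k := if (2 <= t <= n - 3) && (r == 1)
           then (2 * n - 4) %/ (1 + t) + 1
           else 2 * ceil_divn (n - 1) (1 + t) in
  is_kappa (BCDC n) (star t) k /\ is_kappa_s (BCDC n) (star t) k.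
Proof.
move=> r k; have {r k}-> : k = kappa_value n t by [].
have lower (F : {set subgraph (BCDC n)}) :
    substructure_cut (star t) F -> kappa_value n t <= #|F|.
  case=> cutF subF; apply: kappa_lower => // S /subF[K].
  exact: substructure_starlike.
have [F strF F_le] := kappa_upper hn ht.
have cardF : #|F| = kappa_value n t.
  by apply/eqP; rewrite eqn_leq F_le lower //; apply: structure_substructure.
split; split.
- by exists F.
- by move=> F' /structure_substructure; apply: lower.
- by exists F => //; apply: structure_substructure.
- exact: lower.
Qed.
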